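(* (Wrapping-averaging formula) Let $\Sigma$ be a complete fan in $\mathbb{R}^n$, $\phi$ a strictly concave rational PL function on $\Sigma$, and $r\in\mathbb{N}^+$ such that $r\phi$ is integral. For any $\rho\in\Sigma(1)$ and any $a\in(0,\infty)$ one has $$w_{\rho,r\phi}(a)=2\pi\langle\overline{m}_{\rho,r\phi}(a),u_\rho\rangle.$$
   Context: Let $n\ge 1$. A complete fan $\Sigma$ in $\mathbb{R}^n$ is a finite collection of strongly convex rational polyhedral cones, closed under taking faces and intersections (two cones meet along a common face), whose union is $\mathbb{R}^n$. $\Sigma(k)$ is the set of $k$-dimensional cones; for a ray $\rho\in\Sigma(1)$, $u_\rho\in\mathbb{Z}^n$ is its primitive generator. A PL function on $\Sigma$ is a continuous $\phi:\mathbb{R}^n\to\mathbb{R}$ linear on each cone; for $\sigma\in\Sigma(n)$ write $\phi|_\sigma=\langle m_\sigma,\cdot\rangle$. It is rational (resp. integral) if all $m_\sigma\in\mathbb{Q}^n$ (resp. $\mathbb{Z}^n$). It is strictly concave if $\phi(x)=\min_{\sigma\in\Sigma(n)}\langle m_\sigma,x\rangle$ for all $x$ and, for every $\sigma\in\Sigma(n)$, $\phi(x)=\langle m_\sigma,x\rangle$ if and only if $x\in\sigma$. Set $P_{r\phi}=\{m\in\mathbb{R}^n:\langle m,u_\rho\rangle\ge r\phi(u_\rho)\ \forall\rho\in\Sigma(1)\}$. For $m\in\mathbb{Z}^n$ let $\chi^m(z)=z_1^{m^{(1)}}\cdots z_n^{m^{(n)}}$ on $(\mathbb{C}^\times)^n$,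 and $$\theta_{r\phi}=-\frac{i}{2}\sum_{k=1}^n\frac{\sum_{m\in P_{r\phi}\cap\mathbb{Z}^n}m^{(k)}|\chi^m|^2}{\sum_{m\in P_{r\phi}\cap\mathbb{Z}^n}|\chi^m|^2}\left(\frac{dz_k}{z_k}-\frac{d\overline{z}_k}{\overline{z}_k}\right).$$ Let $\lambda_{u_\rho}:\mathbb{C}^\times\to(\mathbb{C}^\times)^n$, $\lambda_{u_\rho}(t)=(t^{u_\rho^{(1)}},\dots,t^{u_\rho^{(n)}})$. The wrapping function is $w_{\rho,r\phi}:(0,\infty)\to\mathbb{R}$, $w_{\rho,r\phi}(a)=\int_{|t|=a}\lambda_{u_\rho}^*\theta_{r\phi}$ (circle oriented counterclockwise). The lattice average function is $$\overline{m}_{\rho,r\phi}:(0,\infty)\to\mathbb{R}^n,\quad \overline{m}_{\rho,r\phi}(a)=\frac{\sum_{m\in P_{r\phi}\cap\mathbb{Z}^n}a^{2\langle m,u_\rho\rangle}m}{\sum_{m\in P_{r\phi}\cap\mathbb{Z}^n}a^{2\langle m,u_\rho\rangle}}.$$ *)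

(* Defs.v *)
From HB Require Import structures.
From mathcomp Require Import all_boot all_order all_algebra.
From mathcomp Require Import all_classical all_reals all_analysis.
From mathcomp.real_closed Require Export complex.

Set Implicit Arguments.
Unset Strict Implicit.
Unset Printing Implicit Defensive.

Import Order.TTheory GRing.Theory Num.Theory.
Import numFieldNormedType.Exports.

Local Open Scope classical_set_scope.
Local Open Scope complex_scope.
Local Open Scope ring_scope.

Definition dot (T : pzRingType) n (x y : 'rV[T]_n) : T :=
  \sum_(k < n) x 0 k * y 0 k.

(* The inclusion Z^n -> R^n. *)
Definition intv (R : pzRingType) n (m : 'rV[int]_n) : 'rV[R]_n :=
  map_mx intr m.

Section Fans.
Variables (R : realType) (n : nat).
Implicit Types (C F : set 'rV[R]_n) (Sigma : set (set 'rV[R]_n)).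

Definition cone_hull (s : seq 'rV[int]_n) : set 'rV[R]_n :=
  [set x | exists2 c : 'I_(size s) -> R, forall i, 0 <= c i &
     x = \sum_(i < size s) c i *: intv R (nth 0 s i)].

Definition rational_polyhedral C := exists s, C = cone_hull s.

Definition strongly_convex C := forall x, C x -> C (- x) -> x = 0.

Definition is_face F C :=
  exists2 m : 'rV[R]_n, forall x, C x -> 0 <= dot m x &
    F = C `&` [set x | dot m x = 0].

Definition fan Sigma :=
  [/\ finite_set Sigma,
      forall C, Sigma C -> rational_polyhedral C /\ strongly_convex C,
      forall C F, Sigma C -> is_face F C -> Sigma F &
      forall C D, Sigma C -> Sigma D ->
        is_face (C `&` D) C /\ is_face (C `&` D) D].

Definition complete_fan Sigma := fan Sigma /\ \bigcup_(C in Sigma) C = setT.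

(* U below is the linear span of C: the least subspace containing C. *)
Definition cone_dim C (k : nat) :=
  exists2 U : {vspace 'rV[R]_n},
    forall V : {vspace 'rV[R]_n}, (U <= V)%VS <-> (forall x, C x -> x \in V) &
    \dim U = k.

(* Sigma(k) *)
Definition cones_of_dim Sigma (k : nat) : set (set 'rV[R]_n) :=
  [set C | Sigma C /\ cone_dim C k].

(* u is a primitive generator of rho when the semigroup of lattice points of
   rho is N u; for a rational ray rho there is exactly one such u. *)
Definition primitive_generator (rho : set 'rV[R]_n) (u : 'rV[int]_n) :=
  [set v : 'rV[int]_n | rho (intv R v)] = range (fun k : nat => u *+ k).

(* u_rho *)
Definition ray_gen (rho : set 'rV[R]_n) : 'rV[int]_n :=
  xget 0 [set u | primitive_generator rho u].

End Fans.

Section PL.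
Variables (R : realType) (n : nat).
Implicit Types (Sigma : set (set 'rV[R]_n)) (phi : 'rV[R]_n -> R).

Definition linear_on phi (C : set 'rV[R]_n) (m : 'rV[R]_n) :=
  forall x, C x -> phi x = dot m x.

Definition PL_function Sigma phi :=
  continuous phi /\ forall C, Sigma C -> exists m, linear_on phi C m.

(* m_sigma, which is unique when sigma is full-dimensional. *)
Definition slope phi (C : set 'rV[R]_n) : 'rV[R]_n :=
  xget 0 [set m | linear_on phi C m].

Definition rational_PL Sigma phi :=
  PL_function Sigma phi /\
  forall C, cones_of_dim Sigma n C ->
    exists q : 'rV[rat]_n, slope phi C = map_mx ratr q.

Definition integral_PL Sigma phi :=
  PL_function Sigma phi /\
  forall C, cones_of_dim Sigma n C ->
    exists z : 'rV[int]_n, slope phi C = intv R z.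

Definition is_minimum (A : set R) (y : R) := A y /\ lbound A y.

Definition strictly_concave Sigma phi :=
  (forall x, is_minimum [set dot (slope phi C) x | C in cones_of_dim Sigma n]
               (phi x)) /\
  (forall C, cones_of_dim Sigma n C ->
     forall x, phi x = dot (slope phi C) x <-> C x).

Definition polytope Sigma phi : set 'rV[R]_n :=
  [set m | forall rho, cones_of_dim Sigma 1 rho ->
     phi (intv R (ray_gen rho)) <= dot m (intv R (ray_gen rho))].

(* Sums over this set are written with the finitely supported sum of fsbigop;
   it is finite for a complete fan, as the polytope is then bounded. *)
Definition lattice_points Sigma phi : set 'rV[int]_n :=
  [set m | polytope Sigma phi (intv R m)].

End PL.

Section Forms.
Variable R : realType.

(* A complex-valued 1-form on an open subset of C^n, regarded as a real
   manifold: it maps a point and a tangent vector (an element of C^n) to a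
   complex number. Values outside the domain of the form are irrelevant. *)
Definition form (n : nat) : Type := 'rV[R[i]]_n -> 'rV[R[i]]_n -> R[i].

Definition dz n (k : 'I_n) : form n := fun _ v => v 0 k.
Definition dzbar n (k : 'I_n) : form n := fun _ v => conjc (v 0 k).

(* 1-forms on an open subset of C. *)
Definition form1 : Type := R[i] -> R[i] -> R[i].

(* Derivative of a curve in C with respect to its real parameter. *)
Definition curve_deriv (g : R -> R[i]) (s : R) : R[i] :=
  derive1 (fun x : R => complex.Re (g x)) s
  +i* derive1 (fun x : R => complex.Im (g x)) s.

(* The real differential at t of a smooth map f from an open subset of C to
   C^n, applied to the tangent vector w. *)
Definition differential n (f : R[i] -> 'rV[R[i]]_n) (t w : R[i]) :
    'rV[R[i]]_n :=
  \row_(k < n) curve_deriv (fun s : R => f (t + s%:C * w) 0 k) 0.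

Definition pullback n (f : R[i] -> 'rV[R[i]]_n) (theta : form n) : form1 :=
  fun t w => theta (f t) (differential f t w).

Definition complex_integral (D : set R) (f : R -> R[i]) : R[i] :=
  (\int[lebesgue_measure]_(s in D) complex.Re (f s))
  +i* (\int[lebesgue_measure]_(s in D) complex.Im (f s)).

(* s |-> a e^(is) *)
Definition circle (a s : R) : R[i] := (a * cos s) +i* (a * sin s).

(* Integral over the circle |t| = a, oriented counterclockwise. *)
Definition circle_integral (a : R) (eta : form1) : R[i] :=
  complex_integral `[0, 2 * pi]
    (fun s => eta (circle a s) (curve_deriv (circle a) s)).

End Forms.

Section Wrapping.
Variables (R : realType) (n : nat).
Implicit Types (Sigma : set (set 'rV[R]_n)) (psi : 'rV[R]_n -> R).

(* chi^m *)
Definition monomial (m : 'rV[int]_n) (z : 'rV[R[i]]_n) : R[i] :=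
  \prod_(k < n) z 0 k ^ m 0 k.

Definition theta Sigma psi : form R n := fun z v =>
  - ('i%C / 2) * \sum_(k < n)
    (\sum_(m \in lattice_points Sigma psi) (m 0 k)%:~R * `|monomial m z| ^+ 2)
    / (\sum_(m \in lattice_points Sigma psi) `|monomial m z| ^+ 2)
    * (dz k z v / z 0 k - dzbar k z v / conjc (z 0 k)).

(* The one-parameter subgroup t |-> (t^u_1, ..., t^u_n). *)
Definition one_param (u : 'rV[int]_n) (t : R[i]) : 'rV[R[i]]_n :=
  \row_(k < n) t ^ u 0 k.

(* The value is real, but is an element of C by definition. *)
Definition wrapping Sigma psi (rho : set 'rV[R]_n) (a : R) : R[i] :=
  circle_integral a (pullback (one_param (ray_gen rho)) (theta Sigma psi)).

Definition lattice_average Sigma psi (rho : set 'rV[R]_n) (a : R) : 'rV[R]_n :=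
  (\sum_(m \in lattice_points Sigma psi) a ^ (2 * dot m (ray_gen rho)))^-1
  *: \sum_(m \in lattice_points Sigma psi)
       a ^ (2 * dot m (ray_gen rho)) *: intv R m.

End Wrapping.

(* Main.v *)
(* On |t| = a the absolute value of chi^m(lambda_u(t)) depends only on a: its
   square is a^(2<m,u>).  The circle is the flow of i t d/dt and dz_k/z_k pulls
   back along lambda_u to u_k dt/t, so that dz_k/z_k - dzbar_k/zbar_k takes the
   value 2 i u_k on the velocity.  Hence theta takes the constant value
   <mbar(a), u> there, and the circle has parameter length 2 pi. *)
Require Import Defs.
From HB Require Import structures.
From mathcomp Require Import all_boot all_order all_algebra.
From mathcomp Require Import all_classical all_reals all_analysis.
From mathcomp.real_closed Require Import complex.
From mathcomp Require Import ring.

Import Order.TTheory GRing.Theory Num.Theory.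
Import numFieldNormedType.Exports.

Local Open Scope classical_set_scope.
Local Open Scope complex_scope.
Local Open Scope ring_scope.

Set Implicit Arguments.
Unset Strict Implicit.
Unset Printing Implicit Defensive.

(** [curve_deriv] has a value even where a curve is not differentiable. This relation also records
    differentiability of both real components, so that derivative rules can be chained. *)
Definition is_curve_deriv (R : realType) (g : R -> R[i]) (s : R) (d : R[i]) :=
  is_derive s 1 (fun x => complex.Re (g x)) (complex.Re d) /\
  is_derive s 1 (fun x => complex.Im (g x)) (complex.Im d).

Lemma curve_deriv_val (R : realType) (g : R -> R[i]) (s : R) (d : R[i]) :
  is_curve_deriv g s d -> curve_deriv g s = d.
Proof.
move=> [[_ gr] [_ gi]]; rewrite /curve_deriv !derive1E gr gi.
by case: d {gr gi}.
Qed.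

Lemma is_curve_deriv_cst (R : realType) (c : R[i]) (s : R) :
  is_curve_deriv (fun=> c) s 0.
Proof. by split; exact: is_derive_cst. Qed.

Lemma is_curve_deriv_line (R : realType) (t w : R[i]) (s : R) :
  is_curve_deriv (fun x => t + x%:C * w) s w.
Proof.
case: t w => [t1 t2] [w1 w2]; split=> /=.
- by apply: is_derive_eq; rewrite /GRing.scale /=; ring.
- by apply: is_derive_eq; rewrite /GRing.scale /=; ring.
Qed.

Lemma is_curve_derivM (R : realType) (g h : R -> R[i]) (s : R) (d e : R[i]) :
  is_curve_deriv g s d -> is_curve_deriv h s e ->
  is_curve_deriv (fun x => g x * h x) s (d * h s + g s * e).
Proof.
case: d e => [d1 d2] [e1 e2] [/= gr gi] [/= hr hi].
have reM (x y : R[i]) : complex.Re (x * y) =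
    complex.Re x * complex.Re y - complex.Im x * complex.Im y.
  by case: x y => [x1 x2] [y1 y2].
have imM (x y : R[i]) : complex.Im (x * y) =
    complex.Re x * complex.Im y + complex.Im x * complex.Re y.
  by case: x y => [x1 x2] [y1 y2].
split.
- under eq_fun do rewrite reM.
  apply: is_derive_eq.
  by case: (g s) (h s) => [? ?] [? ?]; rewrite /GRing.scale /=; ring.
- under eq_fun do rewrite imM.
  apply: is_derive_eq.
  by case: (g s) (h s) => [? ?] [? ?]; rewrite /GRing.scale /=; ring.
Qed.

Lemma is_curve_derivV (R : realType) (g : R -> R[i]) (s : R) (d : R[i]) :
  g s != 0 -> is_curve_deriv g s d ->
  is_curve_deriv (fun x => (g x)^-1) s (- d / g s ^+ 2).
Proof.
move=> gs0 [gr gi].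
(* [N] is the squared modulus of [g]; the inverse is the conjugate of [g] divided by [N], which
   reduces the claim to real quotient rules. *)
pose N x := complex.Re (g x) ^+ 2 + complex.Im (g x) ^+ 2.
have N0 : N s != 0.
  apply: contra gs0; rewrite /N paddr_eq0 ?sqr_ge0 // !sqrf_eq0.
  by rewrite eq_complex.
have reV x : complex.Re (g x)^-1 = complex.Re (g x) * (N x)^-1.
  by rewrite /N; case: (g x).
have imV x : complex.Im (g x)^-1 = - complex.Im (g x) * (N x)^-1.
  by rewrite /N; case: (g x) => p q; rewrite /= mulNr.
pose M := 2 * (complex.Re (g s) * complex.Re d
  + complex.Im (g s) * complex.Im d).
have dN : is_derive s 1 N M.
  by apply: is_derive_eq; rewrite /M /GRing.scale /=; ring.
have dV := is_deriveV N0 dN.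
(* The target is put in the shape that the quotient rule gives for the two components, with [M] the
   derivative of [N]. *)
have -> : - d / g s ^+ 2 =
    (complex.Re d * (N s)^-1 - complex.Re (g s) * (N s)^-1 ^+ 2 * M)
    +i* (- complex.Im d * (N s)^-1 + complex.Im (g s) * (N s)^-1 ^+ 2 * M).
  apply: (mulIf (expf_neq0 2 gs0)); rewrite divfK ?expf_neq0//.
  move: N0; rewrite /M /N; case: (g s) (d) => p q [d1 d2] /= N0; rewrite expr2.
  by apply/eqP; rewrite eq_complex /=; apply/andP; split; apply/eqP; field.
split.
- under eq_fun do rewrite reV.
  by apply: is_derive_eq; rewrite /GRing.scale /= -exprVn; ring.
- under eq_fun do rewrite imV.
  by apply: is_derive_eq; rewrite /GRing.scale /= -exprVn; ring.
Qed.

(** The logarithmic form [m * (d / g)] avoids the exponent [m - 1], so one formula serves all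
    integers: induction for [m >= 0], then the inverse rule for [m < 0]. *)
Lemma is_curve_derivXz (R : realType) (g : R -> R[i]) (s : R) (d : R[i])
    (m : int) : g s != 0 -> is_curve_deriv g s d ->
  is_curve_deriv (fun x => g x ^ m) s (g s ^ m * (m%:~R * (d / g s))).
Proof.
move=> gs0 dg.
have dX (k : nat) :
    is_curve_deriv (fun x => g x ^+ k) s (g s ^+ k * (k%:R * (d / g s))).
  elim: k => [|k IH].
    by rewrite expr0 mul0r mulr0; exact: is_curve_deriv_cst.
  have := is_curve_derivM dg IH; under eq_fun do rewrite -exprS.
  by congr is_curve_deriv; rewrite exprS -natr1; field.
case: m => k; first exact: dX.
have := is_curve_derivV (expf_neq0 k.+1 gs0) (dX k.+1).
congr is_curve_deriv; rewrite NegzE -exprnN rmorphN /=.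
rewrite -pmulrn; field; apply/andP; split=> //; exact: expf_neq0.
Qed.

Lemma is_curve_deriv_circle (R : realType) (a s : R) :
  is_curve_deriv (circle a) s ('i%C * circle a s).
Proof.
by split; rewrite /=; apply: is_derive_eq; rewrite /GRing.scale /=; ring.
Qed.

Lemma norm_circle (R : realType) (a s : R) : 0 < a -> `|circle a s| = a%:C.
Proof.
move=> a0; rewrite normc_def /= !exprMn -mulrDr cos2Dsin2 mulr1.
by rewrite sqrtr_sqr gtr0_norm.
Qed.

Lemma differential_one_param (R : realType) (n : nat) (u : 'rV[int]_n)
    (t w : R[i]) (k : 'I_n) : t != 0 ->
  differential (one_param u) t w 0 k = t ^ u 0 k * ((u 0 k)%:~R * (w / t)).
Proof.
move=> t0; rewrite mxE; apply: curve_deriv_val.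
under eq_fun do rewrite mxE.
(* [differential] is taken at parameter 0, where the line passes through [t]; the nonvanishing
   condition thus becomes [t != 0]. *)
have t0' : t + 0%:C * w = t by rewrite rmorph0 mul0r addr0.
have := is_curve_derivXz (u 0 k) _ (is_curve_deriv_line t w 0).
by rewrite t0'; exact.
Qed.

Lemma monomial_one_param (R : realType) (n : nat) (m u : 'rV[int]_n)
    (t : R[i]) : t != 0 -> monomial m (one_param u t) = t ^ dot m u.
Proof.
move=> t0; rewrite /monomial /dot.
rewrite (big_morph (fun z : int => t ^ z) (id1 := 1) (op1 := *%R)) //; last first.
  by move=> x y; rewrite expfzDr.
by apply: eq_bigr => k _; rewrite mxE exprz_exp mulrC.
Qed.

Lemma sqr_norm_monomial (R : realType) (n : nat) (m u : 'rV[int]_n)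
    (t : R[i]) (a : R) : 0 < a -> `|t| = a%:C ->
  `|monomial m (one_param u t)| ^+ 2 = (a ^ (2 * dot m u))%:C.
Proof.
move=> a0 ta; have t0 : t != 0.
  by rewrite -normr_eq0 ta eq_complex /= eqxx andbT gt_eqF.
have norm_exp (k : int) : `|t ^ k| = `|t| ^ k.
  by case: k => k; rewrite ?NegzE -?exprnN ?normfV normrX.
rewrite monomial_one_param // norm_exp ta exprnP exprz_exp mulrC.
by rewrite [RHS]fmorphXz.
Qed.

(** The embedding of R in R[i] is injective, so [F] and its image have the same support in [P]; both
    sums run over the same indices, or are both empty when that support is infinite. *)
Lemma real_complex_fsum (R : realType) (I : choiceType) (P : set I)
    (F : I -> R) : (\sum_(i \in P) F i)%:C = \sum_(i \in P) (F i)%:C.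
Proof.
rewrite rmorph_sum /=; congr (\big[_/_]_(i <- _) _).
rewrite /finite_support !unlock; congr (finmap.enum_fset (fset_set (P `&` _))).
apply/seteqP; split => i /= F0; first by move=> [] /F0.
by move=> Fi; apply: F0; rewrite Fi.
Qed.

(* When there are infinitely many lattice points, both sides vanish, since the
   finitely supported sum of the weights is then 0, as is its inverse. *)
Lemma lattice_averageE (R : realType) (n : nat) (Sigma : set (set 'rV[R]_n))
    (psi : 'rV[R]_n -> R) (rho : set 'rV[R]_n) (a : R) (k : 'I_n) : 0 < a ->
  lattice_average Sigma psi rho a 0 k =
  (\sum_(m \in lattice_points Sigma psi)
     (m 0 k)%:~R * a ^ (2 * dot m (ray_gen rho)))
  / (\sum_(m \in lattice_points Sigma psi) a ^ (2 * dot m (ray_gen rho))).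
Proof.
move=> a0; rewrite mxE mulrC.
have [fin|inf] := pselect (finite_set (lattice_points Sigma psi)).
  rewrite !fsbig_finite // summxE; congr (_ / _).
  by apply: eq_bigr => m _; rewrite !mxE mulrC.
rewrite [X in X^-1](_ : _ = 0) ?invr0 ?mulr0 //; apply: fsbig_dflt.
(* Every weight is a power of [a > 0], hence nonzero, so the support is the whole infinite set of
   lattice points. *)
rewrite (_ : _ `&` _ = lattice_points Sigma psi) //.
apply/seteqP; split=> [m []//|m Lm]; split=> //=.
by apply/eqP; rewrite expfz_neq0 ?gt_eqF.
Qed.

Lemma theta_circle (R : realType) (n : nat) (Sigma : set (set 'rV[R]_n))
    (psi : 'rV[R]_n -> R) (u : 'rV[int]_n) (a s : R) : 0 < a ->
  pullback (one_param u) (theta Sigma psi) (circle a s)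
    (curve_deriv (circle a) s) =
  (\sum_(k < n) (\sum_(m \in lattice_points Sigma psi)
       (m 0 k)%:~R * a ^ (2 * dot m u))
    / (\sum_(m \in lattice_points Sigma psi) a ^ (2 * dot m u))
    * (u 0 k)%:~R)%:C.
Proof.
move=> a0; have ta := norm_circle s a0.
have t0 : circle a s != 0.
  by rewrite -normr_eq0 ta eq_complex /= eqxx andbT gt_eqF.
rewrite /pullback /theta (curve_deriv_val (is_curve_deriv_circle a s)).
rewrite rmorph_sum mulr_sumr; apply: eq_bigr => k _.
pose L := lattice_points Sigma psi; rewrite -/L.
have denE : \sum_(m \in L) `|monomial m (one_param u (circle a s))| ^+ 2 =
    (\sum_(m \in L) a ^ (2 * dot m u))%:C.
  rewrite real_complex_fsum; apply: eq_fsbigr => m _.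
  exact: sqr_norm_monomial.
have numE : \sum_(m \in L) (m 0 k)%:~R *
      `|monomial m (one_param u (circle a s))| ^+ 2 =
    (\sum_(m \in L) (m 0 k)%:~R * a ^ (2 * dot m u))%:C.
  rewrite real_complex_fsum; apply: eq_fsbigr => m _.
  by rewrite (sqr_norm_monomial m u a0 ta) rmorphM /= rmorph_int.
rewrite denE numE.
set v := differential _ _ _; set z := one_param u _.
(* The velocity of the circle at [t] is [i t], so [w / t] is [i]. *)
have dlog : v 0 k / z 0 k = (u 0 k)%:~R * 'i%C.
  rewrite /v /z differential_one_param // mxE mulfK //.
  by rewrite mulrAC divff ?expfz_neq0 // mul1r.
have dlogbar : conjc (v 0 k) / conjc (z 0 k) = - ((u 0 k)%:~R * 'i%C).
  rewrite -conjc_inv -rmorphM /= dlog rmorphM rmorph_int -mulrN.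
  by congr (_ * _); apply/eqP; rewrite eq_complex /= oppr0 !eqxx.
rewrite /dz /dzbar dlog dlogbar opprK.
have i2 : 'i%C * 'i%C = -1 :> R[i] by rewrite -expr2 sqr_i.
(* The quotient becomes an opaque [q], as its denominator is 0 by default if there are infinitely
   many lattice points; what remains is that [-i/2] times [2i] is 1. *)
rewrite 2!rmorphM fmorphV rmorph_int /=; move: (_%:C / _%:C) => q.
transitivity (- ('i%C * 'i%C) * (q * (u 0 k)%:~R)); first by field.
by rewrite i2 opprK mul1r.
Qed.

Lemma complex_integral_cst (R : realType) (b c : R) : 0 <= b ->
  complex_integral `[0, b] (fun=> c%:C) = (b * c)%:C.
Proof.
move=> b0; rewrite /complex_integral /= !Rintegral_cst // mul0r mulrC.
have -> : fine (lebesgue_measure `[0, b]) = b; last by [].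
rewrite lebesgue_measure_itv /= lte_fin.
(* The measure of an interval is given by cases on [0 < b]; for [b = 0] it is 0, again equal to
   [b]. *)
by case: ltgtP b0 => //= _ _; rewrite subr0.
Qed.

Theorem proposition6p6 (R : realType) (n : nat) (hn : (1 <= n)%N)
    (Sigma : set (set 'rV[R]_n)) (phi : 'rV[R]_n -> R) (r : nat)
    (hSigma : complete_fan Sigma)
    (hphi : rational_PL Sigma phi)
    (hconc : strictly_concave Sigma phi)
    (hr : (0 < r)%N)
    (hint : integral_PL Sigma (fun x => r%:R * phi x))
    (rho : set 'rV[R]_n) (hrho : cones_of_dim Sigma 1 rho)
    (a : R) (ha : 0 < a) :
  wrapping Sigma (fun x => r%:R * phi x) rho a =
  (2 * pi * dot (lattice_average Sigma (fun x => r%:R * phi x) rho a)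
                (intv R (ray_gen rho)))%:C.
Proof.
rewrite /wrapping /circle_integral.
rewrite (funext (fun s => theta_circle _ _ _ s ha)).
rewrite complex_integral_cst ?mulr_ge0 ?pi_ge0 //; congr (_ * _)%:C.
by apply: eq_bigr => k _; rewrite lattice_averageE // mxE.
Qed.
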